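(* Let $G$ be a word hyperbolic group with a generating set of cardinality $s \in \mathbb{N}$. Suppose that each proper subgroup of $G$ which is free of rank $s$ and quasiconvex in $G$ is engulfed in $G$. Then the intersection of all finite index subgroups of $G$ is finite. If, moreover, $G$ is torsion-free, then $G$ is residually finite.
   Context: $\mathbb{N}$ denotes the positive integers. Let $G$ be a word (Gromov) hyperbolic group with a finite symmetrized generating set $\mathcal{A}$ and Cayley graph $\Gamma(G,\mathcal{A})$. A subset $Q \subseteq G$ is quasiconvex if there exists $\eta \ge 0$ such that for any $u,v \in Q$, every geodesic segment in $\Gamma(G,\mathcal{A})$ connecting $u$ and $v$ lies in the closed $\eta$-neighborhood of $Q$; for hyperbolic groups this does not depend on the choice of the finite generating set. A subgroup $H \le G$ is said to be engulfed (in $G$) if it is contained in a proper finite index subgroup of $G$. *)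

(* Defs.v *)
From mathcomp Require Import all_boot all_order all_algebra fingroup.
From mathcomp Require Import boolp classical_sets functions cardinality.

Set Implicit Arguments.
Unset Strict Implicit.
Unset Printing Implicit Defensive.

Local Open Scope classical_set_scope.
Local Open Scope group_scope.

Section Groups.
Variable G : groupType.
Implicit Types (H L S : set G) (g x y : G).

Definition subgroup H : Prop := group_closed [in H].

Definition generates S : Prop := smallest subgroup S = setT.

Definition left_cosets L : set (set G) := range (fun g => [set g * x | x in L]).

Definition finite_index L : Prop := finite_set (left_cosets L).

Definition engulfed H : Prop :=
  exists L, [/\ subgroup L, finite_index L, L <> setT & H `<=` L].

Definition finite_residual : set G :=
  \bigcap_(L in [set L | subgroup L /\ finite_index L]) L.

Definition residually_finite : Prop :=
  forall g, g <> 1 ->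
    exists (F : finGroupType) (phi : {multiplicative G -> F}), phi g <> 1.

Definition torsion_free : Prop :=
  forall g n, (0 < n)%N -> g ^+ n = 1 -> g = 1.

(* A homomorphism from H to K is a map on G, considered only on H, that is
   multiplicative there. *)
Definition hom_on H (K : groupType) (phi : G -> K) : Prop :=
  forall x y, H x -> H y -> phi (x * y) = phi x * phi y.

(* Universal property of the free group on the family b. It forces b to be
   injective and its image to generate H. *)
Definition free_basis n (b : 'I_n -> G) H : Prop :=
  (forall i, H (b i)) /\
  forall (K : groupType) (f : 'I_n -> K), exists phi : G -> K,
    [/\ hom_on H phi, forall i, phi (b i) = f i &
        forall psi : G -> K, hom_on H psi -> (forall i, psi (b i) = f i) ->
          forall x, H x -> psi x = phi x].

Definition free_of_rank n H : Prop :=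
  subgroup H /\ exists b : 'I_n -> G, free_basis b H.

End Groups.

Arguments finite_residual G : clear implicits.
Arguments residually_finite G : clear implicits.
Arguments torsion_free G : clear implicits.

Section CayleyGraph.
Variables (G : groupType) (A : set G).
Implicit Types (x y z u v w : G) (p q : seq G).

Definition finite_symmetrized_generating_set : Prop :=
  [/\ finite_set A, forall a, A a -> A a^-1 & generates A].

(* The edges of the Cayley graph join g to g * a, for a in A. *)
Definition cayley : rel G := [rel x y | x^-1 * y \in A].

(* As in path.v, a path x = x_0, x_1, ..., x_n is given by x and
   p = [:: x_1; ...; x_n], so its length is size p. *)
Definition edge_path x y p : Prop := path cayley x p /\ last x p = y.

Definition geodesic x y : set (seq G) :=
  [set p | edge_path x y p /\
           forall q, edge_path x y q -> (size p <= size q)%N].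

(* The length of any geodesic from x to y. The default value 0 is taken only
   if x and y are not connected, which cannot happen when A is a symmetrized
   generating set. *)
Definition word_dist x y : nat := xget 0%N [set size p | p in geodesic x y].

Definition gromov_product w x y : rat :=
  (((word_dist x w)%:R + (word_dist y w)%:R - (word_dist x y)%:R) / 2)%R.

(* Gromov's definition, applied to G with its word metric. All distances are
   integers, so an integer delta loses no generality; the same holds for eta
   below. *)
Definition hyperbolic : Prop :=
  exists delta : nat, forall w x y z,
    (Num.min (gromov_product w x z) (gromov_product w z y) - delta%:R
       <= gromov_product w x y)%R.

Definition quasiconvex (Q : set G) : Prop :=
  exists eta : nat, forall u v p, Q u -> Q v -> geodesic u v p ->
    forall z, z \in u :: p -> exists2 q, Q q & (word_dist z q <= eta)%N.

End CayleyGraph.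

(* Main.v *)
Require Import Defs.
From HB Require Import structures.
From mathcomp Require Import all_boot all_order all_algebra fingroup perm.
From mathcomp Require Import boolp classical_sets functions cardinality.
From mathcomp Require Import zify lra.

Set Implicit Arguments.
Unset Strict Implicit.
Unset Printing Implicit Defensive.

(** Let K be the intersection of the finite index subgroups, a normal subgroup,
    and suppose that K is infinite. Write X = {x_1, ..., x_s}. The idea is to
    find c_i and c_i' in K such that the elements c_i * x_i * c_i' freely
    generate a proper quasiconvex subgroup H. By hypothesis H lies in a proper
    subgroup L of finite index. But L contains K, so it contains every x_i, and
    L = G, a contradiction. Hence K is finite. If moreover G is torsion-free,
    K is trivial, and the action of G on the cosets of a finite index subgroup
    that misses g is a finite quotient in which g survives.

    The c_i and c_i' come from ping-pong, in a form that only uses Gromov's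
    four-point inequality. If consecutive letters of a word cancel little and
    each letter is long compared to this cancellation, then the partial products
    stay close to a geodesic (chain_split, chain_track). So if no two letters of
    a family other than inverse ones cancel much (schottky), then its reduced
    words are nontrivial, which gives freeness (schottky_no_relation,
    generated_by_free), and follow geodesics, which gives quasiconvexity
    (generated_by_quasiconvex).

    An infinite subgroup contains an element h with these properties as a
    one-letter family (exists_loxodromic): otherwise all its long elements go
    in one direction, which each of its elements fixes without translating along
    it, so that a conjugate of any finite part of the subgroup fits in a fixed
    ball. Take such an h in K. If the translate by g of the axis of h shares an
    end with this axis, then g lies in one of finitely many left cosets of the
    powers of h (not_transverse_cosets). The powers of h have infinite index in
    G, since otherwise those of h ^+ 2 would have finite index and so contain K,
    hence h. Therefore h has any number of conjugates in K whose axes share no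
    ends (transverse_family), and high powers of these form Schottky families
    with a cancellation bound independent of the power (schottky_powers).
    Inserting the x_i between them keeps the family Schottky, because among
    x_i * c' and x_i * c'^-1 at least one does not run back along c_i
    (schottky_twist). One generator more than needed is built, and H omits it,
    which makes H proper. *)

(** * Four-point geometry of a length function *)

Ltac gnorm :=
  rewrite ?(invMg, mulgA, mulgK, mulgVK, mulVg, mulgV, invgK, mul1g, mulg1,
            invg1).

(** The geometry only uses these properties of the word length. The four-point
    inequality is Gromov's condition cleared of its denominators: distances
    are integers, and k is twice the hyperbolicity constant, so every estimate
    below is linear arithmetic over nat. *)
Record hyperbolic_length (G : groupType) (len : G -> nat) (k : nat) : Prop :=
  HyperbolicLength {
  hl_len1 : len 1%g = 0;
  hl_lenV : forall x, len x^-1%g = len x;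
  hl_lenM : forall x y, len (x * y)%g <= len x + len y;
  hl_four : forall x y z t,
    len (x^-1 * y)%g + len (z^-1 * t)%g <=
      maxn (len (x^-1 * z)%g + len (y^-1 * t)%g)
           (len (x^-1 * t)%g + len (y^-1 * z)%g) + k;
  hl_split : forall x r, r <= len x ->
    exists2 m, len m = r & len (m^-1 * x)%g = len x - r;
  hl_ball : forall r, finite_set [set x | len x <= r]%classic }.

Section MetricNotions.
Local Open Scope group_scope.
Variables (G : groupType) (len : G -> nat).

Definition len_dist (x y : G) := len (x^-1 * y).

(** Twice the Gromov product of p and q at 1. The subtraction never truncates,
    by the triangle inequality (gpE). *)
Definition len_gp (p q : G) := len p + len q - len_dist p q.

(** Twice the Gromov product at 1 of a^-1 and b is at most C: along geodesics
    from 1, at most about C / 2 of the end of a cancels against the beginning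
    of b. *)
Definition len_additive C (a b : G) := len a + len b <= len (a * b) + C.

End MetricNotions.

Ltac revert_props :=
  repeat match goal with
  | H : is_true _ |- _ => revert H
  | H : @eq nat _ _ |- _ => revert H
  end.

(** lia compares its atoms syntactically, whereas equal products may be built
    on different, convertible structures of the group hierarchy. Naming the
    lengths and Gromov products first identifies them up to conversion. *)
Ltac metric_lia len :=
  revert_props; rewrite /len_additive /len_dist;
  repeat (let n := fresh "n" in set n := (len_gp _ _ _); clearbody n);
  repeat (let n := fresh "n" in set n := (len _); clearbody n);
  lia.

Section Geometry.
Local Open Scope group_scope.
Variables (G : groupType) (len : G -> nat) (k : nat).
Hypothesis hl : hyperbolic_length len k.
Implicit Types (x y z p q r a b c : G) (w : seq G) (C D : nat).

Local Notation dist := (len_dist len).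
Local Notation gp := (len_gp len).
Local Notation almost_additive := (len_additive len).
Ltac mlia := metric_lia len.

Lemma distE x y : dist x y = len (x^-1 * y).
Proof. by []. Qed.

Lemma distC x y : dist x y = dist y x.
Proof. by rewrite /len_dist -(hl_lenV hl); gnorm. Qed.

Lemma distM a x y : dist (a * x) (a * y) = dist x y.
Proof. by rewrite /len_dist; gnorm. Qed.

Lemma dist1g x : dist 1 x = len x.
Proof. by rewrite /len_dist; gnorm. Qed.

Lemma dist_triangle z x y : dist x y <= dist x z + dist z y.
Proof.
rewrite /len_dist; have -> : x^-1 * y = (x^-1 * z) * (z^-1 * y) by gnorm.
exact: (hl_lenM hl).
Qed.

Lemma four_point x y z t :
  dist x y + dist z t <=
    maxn (dist x z + dist y t) (dist x t + dist y z) + k.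
Proof. exact: (hl_four hl). Qed.

Lemma gpE p q : gp p q + dist p q = len p + len q.
Proof.
have := dist_triangle 1 p q; rewrite (distC p 1) !dist1g /len_gp; lia.
Qed.

Lemma gpC p q : gp p q = gp q p.
Proof. by rewrite /len_gp distC addnC. Qed.

(** The form of the four-point inequality used most: directions from 1 that are
    both close to q are close to each other. *)
Lemma gp_min q p r : minn (gp p q) (gp q r) <= gp p r + k.
Proof.
have := gpE p q; have := gpE q r; have := gpE p r.
have := four_point p r q 1.
rewrite (distC q 1) (distC p 1) (distC r 1) !dist1g (distC r q).
mlia.
Qed.

Lemma almost_additiveV C a b :
  almost_additive C b^-1 a^-1 = almost_additive C a b.
Proof.
by rewrite /len_additive !(hl_lenV hl) -(hl_lenV hl (a * b)) invMg addnC.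
Qed.

Lemma almost_additiveW C D a b :
  C <= D -> almost_additive C a b -> almost_additive D a b.
Proof. by rewrite /len_additive; mlia. Qed.

(** The hypothesis on b^-1 * y says that b is nearly an initial segment of y,
    so y leaves 1 in the direction of b; if b is long enough, y cannot cancel
    more against a than b does, up to k. *)
Lemma almost_additive_extr C C' a b y :
    almost_additive C a b -> almost_additive C' b (b^-1 * y) ->
    (C + C' + k < 2 * len b)%N ->
  almost_additive (C + k) a y.
Proof.
rewrite /len_additive mulVKg => Cab C'by lt_b.
have := gp_min y a^-1 b.
have := gpE a^-1 y; have := gpE a^-1 b; have := gpE y b.
rewrite (distC y b) /len_dist !(hl_lenV hl) invgK; mlia.
Qed.

Lemma almost_additive_extl C C' x a b :
    almost_additive C' (x * a^-1) a -> almost_additive C a b ->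
    (C + C' + k < 2 * len a)%N ->
  almost_additive (C + k) x b.
Proof.
move=> C'xa Cab lt_a; rewrite -almost_additiveV.
apply: (@almost_additive_extr _ C' _ a^-1).
- by rewrite almost_additiveV.
- by rewrite -almost_additiveV; gnorm; move: C'xa; gnorm.
- by rewrite (hl_lenV hl).
Qed.

Definition prodw w : G := foldr (fun a x => a * x) 1 w.

Lemma prodw_cat w1 w2 : prodw (w1 ++ w2) = prodw w1 * prodw w2.
Proof. by elim: w1 => [|a w1 IH] /=; rewrite ?mul1g // IH mulgA. Qed.

Lemma prodw_rcons w a : prodw (rcons w a) = prodw w * a.
Proof. by rewrite -cats1 prodw_cat /= mulg1. Qed.

Section Chain.
Variable C : nat.

(** In a chain, consecutive letters cancel by at most C and each letter is
    longer than the total loss C + 2 k in chain_split, so that errors do not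
    build up along the product. *)
Definition long a := C + k.*2 < len a.
Definition chain w := sorted (almost_additive C) w && all long w.

Lemma chain_cons a w : chain (a :: w) -> chain w.
Proof.
by case: w => [|b w] //= /andP[/andP[_ ?] /andP[_ ?]]; apply/andP; split.
Qed.

Lemma chain_catl w1 w2 : chain (w1 ++ w2) -> chain w1.
Proof.
rewrite /chain all_cat => /andP[s12 /andP[-> _]]; rewrite andbT.
by case: w1 s12 => // a w1 /=; rewrite cat_path => /andP[].
Qed.

Lemma chain_catr w1 w2 : chain (w1 ++ w2) -> chain w2.
Proof. by elim: w1 => // a w1 IH /chain_cons. Qed.

(** Local to global: by induction b is nearly an initial segment of the product
    of b :: w, so this product cancels against a hardly more than b alone. *)
Lemma chain_head a w :
  chain (a :: w) -> almost_additive (C + k) a (prodw w).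
Proof.
elim: w a => [a _|b w IH a abw].
  by rewrite /len_additive /= mulg1 (hl_len1 hl); mlia.
have Hb := IH b (chain_cons abw).
case/andP: abw => /= /andP[Cab _] /and3P[_ lb _].
apply: (almost_additive_extr (b := b) (C' := C + k)) => //=.
  by rewrite mulKg.
by move: lb; rewrite /long; mlia.
Qed.

Lemma chain_last w b :
  chain (rcons w b) -> almost_additive (C + k) (prodw w) b.
Proof.
elim/last_ind: w b => [b _|w a IH b ch].
  by rewrite /len_additive /= mul1g (hl_len1 hl); mlia.
have Ha : almost_additive (C + k) (prodw w) a.
  by apply: IH; apply: (@chain_catl _ [:: b]); rewrite cats1.
have := @chain_catr w [:: a; b]; rewrite -cat_rcons cats1 => /(_ ch).
case/andP => /= /andP[Cab _] /and3P[la _ _].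
apply: (almost_additive_extl (a := a) (C' := C + k)) => //.
  by rewrite prodw_rcons mulgK.
by move: la; rewrite /long; mlia.
Qed.

(** The partial products of a chain stay near any geodesic from 1 to the full
    product: this says that the Gromov product of the two ends, seen from the
    partial product, is bounded. *)
Lemma chain_split w1 w2 :
  chain (w1 ++ w2) -> almost_additive (C + k.*2) (prodw w1) (prodw w2).
Proof.
case: w2 => [_|b w2 ch].
  by rewrite /len_additive /= mulg1 (hl_len1 hl); mlia.
have H1 : almost_additive (C + k) (prodw w1) b.
  apply: chain_last; rewrite -cats1; apply: (@chain_catl _ w2).
  by rewrite -catA.
have H2 := chain_head (chain_catr ch).
have -> : C + k.*2 = C + k + k by mlia.
apply: (almost_additive_extr H1 (C' := C + k)) => /=; first by rewrite mulKg.
by have /andP[_ /= /andP[]] := chain_catr ch; rewrite /long; mlia.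
Qed.

Lemma chain_gt0 w : chain w -> w <> [::] -> 0 < len (prodw w).
Proof.
case: w => // a w ch _; have := chain_head ch.
by case/andP: ch => _ /= /andP[]; rewrite /long /len_additive; mlia.
Qed.

(** z lies on a geodesic from 1 to the product of the chain. The first partial
    product that is at least as long as z has length within M of len z; both
    lie close to one geodesic at nearly the same distance from 1, hence are
    close to each other. *)
Lemma chain_track M w z :
    chain w -> all (fun a => len a <= M) w ->
    len z + dist z (prodw w) = len (prodw w) ->
  exists2 w1, exists w2, w = w1 ++ w2 & dist z (prodw w1) <= M + C + k.*2 + k.
Proof.
move=> ch leM zP; set P := prodw w in zP.
have exi : exists i, len z <= len (prodw (take i w)).
  by exists (size w); rewrite take_size -/P; mlia.
set i := ex_minn exi; have [zi imin] : len z <= len (prodw (take i w)) /\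
    forall j, len z <= len (prodw (take j w)) -> i <= j.
  by rewrite /i; case: ex_minnP.
have iz : len (prodw (take i w)) <= len z + M.
  case: i zi imin => [|i] zi imin; first by rewrite take0 /= (hl_len1 hl).
  have [ltiw|leiw] := ltnP i (size w); last first.
    have := imin i; rewrite !take_oversize // in zi *; last exact: leqW.
    by move=> /(_ zi); rewrite ltnn.
  have : len (prodw (take i w)) < len z.
    by rewrite ltnNge; apply/negP => /imin; rewrite ltnn.
  rewrite (take_nth 1) // prodw_rcons.
  have := hl_lenM hl (prodw (take i w)) (nth 1 w i).
  by have := all_nthP 1 leM i ltiw; mlia.
exists (take i w); first by exists (drop i w); rewrite cat_take_drop.
set p := prodw (take i w) in zi iz *.
have := chain_split (w1 := take i w) (w2 := drop i w).
rewrite cat_take_drop => /(_ ch).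
rewrite /len_additive -prodw_cat cat_take_drop.
have -> : prodw (drop i w) = p^-1 * P.
  by rewrite /P -{2}(cat_take_drop i w) prodw_cat -/p mulKg.
rewrite -/(dist p P) -/p -/P.
have := gp_min P z p; have := gpE z P; have := gpE z p; have := gpE P p.
rewrite (distC P p); mlia.
Qed.

End Chain.
End Geometry.
(** * Subgroups, finite index and cyclic subgroups *)

Section Subgroups.
Local Open Scope classical_set_scope.
Local Open Scope group_scope.
Variables (G : groupType) (H : set G).
Implicit Types x y g : G.

Lemma subgroupP : subgroup H <->
  [/\ H 1, forall x, H x -> H x^-1 & forall x y, H x -> H y -> H (x * y)].
Proof.
split=> [sH|[H1 HV HM]].
  split=> [|x|x y].
  - by case: sH => + _; rewrite in_setE.
  - by have := group_closedV sH; move=> /(_ x); rewrite !in_setE.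
  - by have := group_closedM sH; move=> /(_ x y); rewrite !in_setE.
split; first by rewrite in_setE.
by move=> x y; rewrite !in_setE => Hx Hy; apply: HM => //; apply: HV.
Qed.

Lemma finite_index_cover (R : seq G) : subgroup H ->
  (forall g, exists2 r, r \in R & H (r^-1 * g)) -> finite_index H.
Proof.
move=> /subgroupP[H1 HV HM] cov.
apply: (@sub_finite_set _ _ [set` [seq [set r * x | x in H] | r <- R]]);
  last first.
  exact: finite_seq.
move=> _ [g _ <-]; have [r rR Hrg] := cov g.
apply/mapP; exists r => //; apply/seteqP; split => _ [x Hx <-].
  by exists (r^-1 * g * x); [exact: HM | rewrite !mulgA mulgV mul1g].
exists (g^-1 * r * x); last by rewrite !mulgA mulgV mul1g.
apply: HM => //; have -> : g^-1 * r = (r^-1 * g)^-1 by rewrite invMg invgK.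
exact: HV.
Qed.

End Subgroups.

Section Powers.
Local Open Scope group_scope.
Variable G : groupType.
Implicit Types (h x y u v : G).

(** Writing an integral power as a quotient avoids integer exponents and makes
    closure under products immediate. *)
Definition powers h : set G :=
  [set x | exists m n, x = h ^+ m / h ^+ n]%classic.

Lemma powersX h n : powers h (h ^+ n).
Proof. by exists n, 0; rewrite expg0 divg1. Qed.

Lemma powers1 h : powers h 1.
Proof. exact: (powersX h 0). Qed.

Lemma powersV h x : powers h x -> powers h x^-1.
Proof. by case=> m [n ->]; exists n, m; rewrite invgF. Qed.

Lemma powersM h x y : powers h x -> powers h y -> powers h (x * y).
Proof.
case=> m [n ->] [p [q ->]]; exists (m + p), (q + n).
have c : h ^- n * h ^+ p = h ^+ p * h ^- n.
  by apply/commute_sym/commuteV; exact: commuteX2.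
by rewrite !expgnDr invMg !mulgA -(mulgA _ _ (h ^+ p)) c !mulgA.
Qed.

Lemma powers_expg h x n : powers h x -> powers h (x ^+ n).
Proof.
move=> hx; elim: n => [|n IH]; first exact: powers1.
by rewrite expgS; apply: powersM.
Qed.

Lemma powers_sign h x : powers h x -> exists n, x = h ^+ n \/ x = h^-1 ^+ n.
Proof.
case=> m [n ->]; have [le_nm|/ltnW le_mn] := leqP n m.
  by exists (m - n); left; rewrite expgnFr.
exists (n - m); right.
by rewrite expVgn expgnFr // invgF.
Qed.

Lemma powers_of_inv h x : powers h^-1 x -> powers h x.
Proof.
case=> m [n ->]; rewrite !expVgn invgK.
by apply: powersM; [apply/powersV|]; exact: powersX.
Qed.

Lemma powers_subgroup h : subgroup (powers h).
Proof.
by apply/subgroupP; split; [exact: powers1 | exact: powersV | exact: powersM].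
Qed.

End Powers.

(** * Loxodromic elements *)

Section Loxodromic.
Local Open Scope group_scope.
Variables (G : groupType) (len : G -> nat) (k : nat).
Hypothesis hl : hyperbolic_length len k.
Implicit Types (x y z p q a c g f u v : G) (C D : nat).
Local Notation dist := (len_dist len).
Local Notation gp := (len_gp len).
Local Notation almost_additive := (len_additive len).
Ltac mlia := metric_lia len.

(** With C := len h - (2 k + 1), this inequality says that h repeated n times is
    a chain. So h moves 1 along a quasi-geodesic; in particular it has infinite
    order. *)
Definition loxodromic h := len h + k.*2 < len (h * h).

Lemma lenX_le x n : len (x ^+ n) <= n * len x.
Proof.
elim: n => [|n IH]; first by rewrite expg0 (hl_len1 hl).
by rewrite expgS mulSn; have := hl_lenM hl x (x ^+ n); mlia.
Qed.

Section Powers.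
Variable h : G.
Hypothesis hlox : loxodromic h.

Lemma prodw_nseq n : prodw (nseq n h) = h ^+ n.
Proof. by elim: n => //= n ->; rewrite -expgS. Qed.

Lemma lox_len_gt : k.*2 < len h.
Proof. by move: hlox; rewrite /loxodromic; have := hl_lenM hl h h; mlia. Qed.

Lemma lox_chain n : chain len k (len h - k.*2.+1) (nseq n h).
Proof.
have := lox_len_gt; move=> lt_k; apply/andP; split.
  case: n => //= n; elim: n => //= n ->; rewrite andbT /len_additive.
  by move: hlox; rewrite /loxodromic; mlia.
by rewrite all_nseq /long; apply/orP; right; mlia.
Qed.

Lemma loxX_additive m n : almost_additive (len h) (h ^+ m) (h ^+ n).
Proof.
have := lox_chain (m + n); rewrite nseqD => /(chain_split hl).
rewrite !prodw_nseq; apply: almost_additiveW.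
by have := lox_len_gt; mlia.
Qed.

Lemma loxX_len n : n <= len (h ^+ n).
Proof.
elim: n => // n IH; rewrite expgSr.
have := lox_chain n.+1; rewrite -(addn1 n) nseqD cats1 => /(chain_last hl).
by rewrite prodw_nseq /len_additive; have := lox_len_gt; mlia.
Qed.

Lemma lox_inj m n : h ^+ m = h ^+ n -> m = n.
Proof.
wlog le_mn : m n / m <= n.
  by move=> H e; have [/H->|/ltnW/H->] := leqP m n.
move=> e; apply/eqP; rewrite eqn_leq le_mn /= -subn_eq0 -leqn0.
by apply: leq_trans (loxX_len _) _; rewrite expgnFr // -e mulgV (hl_len1 hl).
Qed.

End Powers.

Lemma loxV h : loxodromic h -> loxodromic h^-1.
Proof. by rewrite /loxodromic -invMg !(hl_lenV hl). Qed.

Section Tracking.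
Variable h : G.
Hypothesis hlox : loxodromic h.

Definition sign_of h1 := h1 = h \/ h1 = h^-1.

Lemma sign_lox h1 : sign_of h1 -> loxodromic h1.
Proof. by case=> ->; rewrite // ; apply: loxV. Qed.

Lemma sign_len h1 : sign_of h1 -> len h1 = len h.
Proof. by case=> ->; rewrite ?(hl_lenV hl). Qed.

(** The path j |-> h2 ^+ j and its translate j |-> g * h1 ^+ j end at points
    with a large Gromov product at 1. Past a distance depending on g, both
    follow the same geodesic, so each point of the first is close to a point of
    the second, with a bound that depends on neither g nor the endpoints. *)
Lemma axis_track h1 h2 g n m j :
    sign_of h1 -> sign_of h2 -> j <= m ->
    len g + len h + k.*2 < len (h2 ^+ j) ->
    (len (h2 ^+ j)).*2 <= gp (h2 ^+ m) (g * h1 ^+ n) ->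
  exists i, len ((h2 ^+ j)^-1 * g * h1 ^+ i) <= (len h).*2 + k.*2 + k.
Proof.
move=> s1 s2 le_jm far big.
set p := h2 ^+ j in far big *; set P := h2 ^+ m in big.
set y := g * h1 ^+ n in big.
have pP : len p + dist p P <= len P + len h.
  have := loxX_additive (sign_lox s2) j (m - j).
  rewrite (sign_len s2) /len_additive -expgnDr subnKC // -/p -/P.
  suff -> : dist p P = len (h2 ^+ (m - j)) by [].
  by rewrite /len_dist /P -[in h2 ^+ m](subnKC le_jm) expgnDr mulKg.
have py : len p + dist p y <= len y + len h + k.
  have := gp_min hl P p y; have := gpE hl p P; have := gpE hl p y; mlia.
have gpy : dist p y + dist g p <= dist y g + len h + k.*2.
  have := four_point hl 1 y g p; have := dist_triangle hl g 1 p.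
  rewrite !dist1g (distC hl y p); mlia.
have gp_far : len p <= len g + dist g p.
  by have := dist_triangle hl g 1 p; rewrite !dist1g; mlia.
have yg : dist y g = len (h1 ^+ n).
  by rewrite (distC hl) /len_dist /y mulKg.
(* The candidate q is the point of the translated path whose distance to y
   first reaches that of p, counting backwards from y. *)
have exr : exists r, dist p y <= len (h1 ^+ r) by exists n; rewrite -yg; mlia.
set r := ex_minn exr; have [pr rmin] : dist p y <= len (h1 ^+ r) /\
    forall r', dist p y <= len (h1 ^+ r') -> r <= r'.
  by rewrite /r; case: ex_minnP.
have rp : len (h1 ^+ r) <= dist p y + len h.
  case: r pr rmin => [|r] pr rmin; first by rewrite expg0 (hl_len1 hl).
  have : len (h1 ^+ r) < dist p y.
    by rewrite ltnNge; apply/negP => /rmin; rewrite ltnn.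
  have := hl_lenM hl h1 (h1 ^+ r); rewrite -expgS (sign_len s1); mlia.
have le_rn : r <= n by apply: rmin; rewrite -yg; mlia.
exists (n - r); rewrite -mulgA -/(dist p _).
set q := g * h1 ^+ (n - r).
have qy : dist q y = len (h1 ^+ r).
  suff yE : y = q * h1 ^+ r by rewrite /len_dist yE mulKg.
  by rewrite /q -mulgA -expgnDr subnK.
have gq : dist g q = len (h1 ^+ (n - r)) by rewrite /len_dist /q mulKg.
have := loxX_additive (sign_lox s1) (n - r) r.
rewrite (sign_len s1) /len_additive -expgnDr subnK // -yg -qy -gq => gqy.
have := four_point hl p q g y.
rewrite (distC hl p g) (distC hl g y) (distC hl q g); mlia.
Qed.

(** The powers of h and their translates by g have bounded Gromov products at
    1: the axes of h and of g * h * g^-1 share no end. *)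
Definition transverse g :=
  exists D, forall u v, powers h u -> powers h v ->
    len u + len v <= len (u^-1 * g * v) + D.

Lemma transverseV g : transverse g -> transverse g^-1.
Proof.
case=> D HD; exists D => u v hu hv.
have -> : u^-1 * g^-1 * v = (v^-1 * g * u)^-1 by gnorm.
by rewrite (hl_lenV hl) addnC; exact: HD.
Qed.

(** If the axis of h and its translate by g share an end, axis_track places
    arbitrarily many elements h2 ^- j * g * h1 ^+ i in one finite ball. Two of
    them coincide for different j, so g agrees, up to powers of h on both
    sides, with an element f of the ball that conjugates a power of h to a
    power of h. *)
Lemma not_transverse_commensurates :
  exists F : seq G, forall g, ~ transverse g ->
    exists h2 f j b u v, [/\ sign_of h2, f \in F, powers h u & powers h v] /\
      [/\ 0 < b, h2 ^+ b * f = f * u & g = h2 ^+ j * f * v].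
Proof.
have [F FP] := (iffLR (finite_seqP _) (hl_ball hl ((len h).*2 + k.*2 + k))).
exists F => g dep.
(* axis_track applies to every exponent from J0 to J, since h ^+ n is at
   least n long. That is one exponent more than F has elements. *)
pose J0 := (len g + len h + k.*2).+1; pose J := (J0 + size F)%N.
pose D := ((J * len h).*2 + len g)%N.
have {dep} : exists u v, [/\ powers h u, powers h v &
    len (u^-1 * g * v) + D < len u + len v].
  apply: contra_notP dep => no; exists D => u v hu hv.
  by rewrite leqNgt; apply/negP => lt; apply: no; exists u, v.
case=> u [v [/powers_sign[m hu] /powers_sign[n hv]]].
have [h2 s2 {hu}->] : exists2 h2, sign_of h2 & u = h2 ^+ m.
  by case: hu => ->; [exists h; first left|exists h^-1; first right].
have [h1 s1 {hv}->] : exists2 h1, sign_of h1 & v = h1 ^+ n.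
  by case: hv => ->; [exists h; first left|exists h^-1; first right].
move=> big.
have gpbig : (J * len h).*2 < gp (h2 ^+ m) (g * h1 ^+ n).
  have := gpE hl (h2 ^+ m) (g * h1 ^+ n).
  have := hl_lenM hl g^-1 (g * h1 ^+ n); rewrite mulKg (hl_lenV hl).
  by move: big; rewrite /D -mulgA; mlia.
have le_Jm : J <= m.
  have := gpE hl (h2 ^+ m) (g * h1 ^+ n).
  have := dist_triangle hl (h2 ^+ m) 1 (g * h1 ^+ n).
  rewrite !dist1g.
  have := lenX_le h2 m; rewrite (sign_len s2) => *.
  have : J * len h < m * len h by mlia.
  by rewrite ltn_mul2r => /andP[_ /ltnW].
have track j : j <= size F ->
    exists i, (h2 ^+ (J0 + j))^-1 * g * h1 ^+ i \in F.
  move=> le_jF.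
  have /(axis_track s1 s2)-/(_ g n) : (J0 + j <= m)%N.
    by rewrite (leq_trans _ le_Jm) // leq_add2l.
  case.
  - by have := loxX_len (sign_lox s2) (J0 + j); rewrite /J0; mlia.
  - have := lenX_le h2 (J0 + j); rewrite (sign_len s2) => le1.
    have : (J0 + j) * len h <= J * len h.
      by rewrite leq_mul2r leq_add2l le_jF orbT.
    by move: le1 gpbig; mlia.
  - move=> i le_i; exists i.
    suff : [set` F]%classic ((h2 ^+ (J0 + j))^-1 * g * h1 ^+ i) by [].
    by rewrite -FP.
have {}track j : exists i, j <= size F ->
    (h2 ^+ (J0 + j))^-1 * g * h1 ^+ i \in F.
  have [le|gt] := leqP j (size F); last by exists 0.
  by have [i] := track j le; exists i.
have [i iP] := choice track.
pose e j := (h2 ^+ (J0 + j))^-1 * g * h1 ^+ i j.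
have : ~~ uniq (map e (iota 0 (size F).+1)).
  apply/negP => /uniq_leq_size-/(_ F); rewrite size_map size_iota ltnn => H.
  suff : false by [].
  apply: H => x /mapP[j]; rewrite mem_iota => /andP[_ ltj] ->.
  exact: iP.
case/(uniqPn 1) => j [j']; rewrite size_map size_iota => -[lt_jj' lt_j'].
have lt_j := ltn_trans lt_jj' lt_j'.
rewrite !(nth_map 0) ?size_iota // !nth_iota // !add0n => ee.
exists h2, (e j), (J0 + j)%N, (j' - j)%N, (h1 ^- i j * h1 ^+ i j'), (h1 ^- i j).
have powers_h1 n' : powers h (h1 ^+ n').
  by case: s1 => ->; [|apply: powers_of_inv]; exact: powersX.
split; split => //.
- exact: iP.
- by apply: powersM; [apply: powersV|]; exact: powers_h1.
- by apply: powersV; exact: powers_h1.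
- by rewrite subn_gt0.
- rewrite {1}ee /e; have -> : (J0 + j' = (J0 + j) + (j' - j))%N by lia.
  by rewrite expgnDr invMg !mulgA mulgV mul1g mulgK.
- by rewrite /e; gnorm.
Qed.

End Tracking.
End Loxodromic.

Section Transversality.
Local Open Scope group_scope.
Variables (G : groupType) (len : G -> nat) (k : nat).
Hypothesis hl : hyperbolic_length len k.
Implicit Types (x y z a c g f u v : G) (C D : nat).
Local Notation dist := (len_dist len).
Local Notation gp := (len_gp len).
Local Notation almost_additive := (len_additive len).
Local Notation lox := (loxodromic len k).
Ltac mlia := metric_lia len.

Section Existence.
Variable K : set G.
Hypothesis sK : subgroup K.
Hypothesis nolox : forall u, K u -> len (u * u) <= len u + k.*2.

Let KV u : K u -> K u^-1.
Proof. by have [_ + _] := iffLR (subgroupP K) sK; apply. Qed.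
Let KM u v : K u -> K v -> K (u * v).
Proof. by have [_ _] := iffLR (subgroupP K) sK; apply. Qed.

(** Without loxodromics, each u of K moves 1 as a rotation about the midpoint
    of a geodesic from 1 to u would: u and u^-1 agree along the first half of
    their lengths. *)
Lemma nolox_gpV u : K u -> len u <= gp u u^-1 + k.*2.
Proof.
move=> /nolox; have := gpE hl u u^-1.
by rewrite {1}distE -invMg !(hl_lenV hl); mlia.
Qed.

(** If u and v diverged before the middle of the shorter one, then u * v would
    leave 1 along u, its inverse would leave along v^-1, hence along v, and
    u * v would be loxodromic. So all long elements of K go in the same
    direction. *)
Lemma nolox_gp u v : K u -> K v -> minn (len u) (len v) <= gp u v + k.*2 + k.
Proof.
move=> Ku Kv; rewrite leqNgt; apply/negP => lt.
have gu := nolox_gpV Ku; have gv := nolox_gpV Kv.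
have guv := nolox_gpV (KM Ku Kv).
set w := (u * v)^-1 in guv.
have lw : len w = len (u * v) by rewrite (hl_lenV hl).
(* As u agrees with u^-1 beyond the point where u and v part, replacing u
   by u^-1 does not change where they part; likewise for v. *)
have g1 : gp u^-1 v <= gp u v + k.
  by have := gp_min hl u^-1 u v; mlia.
have g2 : gp v^-1 u <= gp u v + k.
  by have := gp_min hl v^-1 v u; rewrite (gpC hl v u); mlia.
have e1 : gp u^-1 v + len (u * v) = len u + len v.
  by have := gpE hl u^-1 v; rewrite distE invgK (hl_lenV hl).
have e2 : gp (u * v) u + len v = len (u * v) + len u.
  by have := gpE hl (u * v) u; rewrite (distC hl) distE mulKg.
have e3 : gp w v^-1 + len u = len (u * v) + len v.
  have := gpE hl w v^-1; rewrite distE lw (hl_lenV hl).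
  by rewrite /w invgK mulgK.
have g3 : gp w u <= gp u v + k.*2.
  by have := gp_min hl w v^-1 u; rewrite (gpC hl v^-1 w); mlia.
have g4 : gp (u * v) w <= gp u v + k.*2 + k.
  have := gp_min hl (u * v) u w.
  by rewrite (gpC hl u (u * v)) (gpC hl u w); mlia.
by mlia.
Qed.

(** Let m be a point of a geodesic from 1 to v, where v is much longer than m.
    Then u, fixing the common direction of the long elements of K without
    translating along it, moves m by a distance that does not depend on u. *)
Lemma nolox_conj u v m : K u -> K v -> len u <= len m ->
    len m + len (m^-1 * v) = len v ->
    (len m).*2 + len u + k.*2 + k <= len v ->
  len (m^-1 * u * m) <= k.*2 + k.*2 + k.
Proof.
move=> Ku Kv le_um mv big.
have KVu := KV Ku; have Kuv := KM KVu Kv.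
have gm : gp m v = (len m).*2.
  by have := gpE hl m v; rewrite distE; mlia.
have g1 : dist u^-1 m <= len m + k.*2 + k.*2.
  have := nolox_gp KVu Kv; have := gp_min hl v u^-1 m; have := gpE hl u^-1 m.
  by rewrite (gpC hl v m) (hl_lenV hl); mlia.
have g2 : len v <= len u + len (u^-1 * v).
  by have := hl_lenM hl u (u^-1 * v); rewrite mulVKg.
have g3 : gp (u^-1 * v) m + k >= (len m).*2.
  have := nolox_gp Kuv Kv; have := gp_min hl v (u^-1 * v) m.
  by rewrite (gpC hl v m); mlia.
(* Seen from v, the point u * m is not farther than m, up to a constant; by
   g5 this also holds seen from 1. *)
have g4 : dist v (u * m) + len m <= len v + k.*2 + k.*2.
  have := gpE hl (u^-1 * v) m; have := nolox_gp Ku Kv; have := gpE hl u v.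
  rewrite -[dist (u^-1 * v) m](distM len u) mulVKg distE.
  by mlia.
have g5 : len (u * m) <= len m + k.*2 + k.*2.
  by move: g1; rewrite distE invgK.
have := four_point hl m (u * m) 1 v.
rewrite -mulgA -distE (distC hl m 1) (distC hl (u * m) 1) !dist1g.
rewrite (distC hl (u * m) v) [dist m v]distE; mlia.
Qed.

End Existence.

(** Otherwise, by nolox_conj, conjugation by one suitable m sends any given
    finite part of K into a fixed ball. Balls are finite, so K would be too. *)
Lemma exists_loxodromic (K : set G) :
  subgroup K -> infinite_set K -> exists2 h, K h & lox h.
Proof.
move=> sK infK; apply: contrapT => no.
have nolox u : K u -> len (u * u) <= len u + k.*2.
  by move=> Ku; rewrite leqNgt; apply/negP => lt; apply: no; exists u.
have [F FP] := (iffLR (finite_seqP _) (hl_ball hl (k.*2 + k.*2 + k))).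
have [B BK ltB] := infinite_set_fset (size F).+1 infK.
pose r := (\max_(u <- finmap.enum_fset B) len u)%N.
(* Balls being finite, K contains an element longer than any bound. *)
have [v Kv big] : exists2 v, K v & (r.*2 + r + k.*2 + k)%N <= len v.
  apply: contrapT => nov; apply: infK.
  apply: sub_finite_set (hl_ball hl (r.*2 + r + k.*2 + k)%N) => v Kv /=.
  by rewrite leqNgt; apply/negP => /ltnW lt; apply: nov; exists v.
have [m lm mv] : exists2 m, len m = r & len (m^-1 * v) = len v - r.
  by apply: (hl_split hl); mlia.
have conjF u : u \in finmap.enum_fset B -> m^-1 * u * m \in F.
  move=> uB; have leu : len u <= r by apply: (leq_bigmax_seq (F := len)).
  suff : [set` F]%classic (m^-1 * u * m) by [].
  rewrite -FP; apply: (nolox_conj sK nolox (v := v)) => //.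
  - exact: BK.
  - by rewrite lm.
  - by rewrite lm mv; mlia.
  - by rewrite lm; mlia.
have : uniq [seq m^-1 * u * m | u <- finmap.enum_fset B].
  rewrite map_inj_uniq ?finmap.fset_uniq // => x y.
  by move=> /mulIg /mulgI.
move=> /uniq_leq_size-/(_ F); rewrite size_map => H.
have : size F < size F.
  apply: leq_trans ltB (H _) => _ /mapP[u uB ->]; exact: conjF.
by rewrite ltnn.
Qed.

Section Independence.
Variable h : G.
Hypothesis hlox : lox h.

(** If f conjugates h2 ^+ b to a power of h, then the set of the h2 ^+ j * f * v
    with v a power of h is covered by the left cosets of h2 ^+ r * f for r < b.
    Only finitely many f occur. *)
Lemma not_transverse_cosets :
  exists R : seq G, forall g, ~ transverse len h g ->
    exists2 r, r \in R & powers h (r^-1 * g).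
Proof.
have [F FP] := not_transverse_commensurates hl hlox.
pose Q f b := (0 < b)%N /\ exists2 u, powers h u & h ^+ b * f = f * u.
have /choice[e eP] f : exists b, (exists b, Q f b) -> Q f b.
  by have [[b Qb]|no] := pselect (exists b, Q f b); [exists b | exists 0].
pose B := (\max_(f <- F) e f)%N.
pose S := [seq h2 ^+ r | h2 <- [:: h; h^-1], r <- iota 0 B].
exists [seq p * f | p <- S, f <- F] => g.
case/FP=> [h2 [f [j [b [u [v [[s2 fF hu hv]]]]]]]].
case=> b0 hbf gE.
have Qf : Q f (e f).
  apply: eP; exists b; split=> //; case: s2 => h2E; subst h2; first by exists u.
  exists u^-1; first exact: powersV.
  by rewrite -[f in LHS](mulgK u) -hbf expVgn !mulgA mulgV mul1g.
have [w hw hef] : exists2 w, powers h w & h2 ^+ e f * f = f * w.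
  case: Qf => _ [w hw hef]; case: s2 => ->; first by exists w.
  exists w^-1; first exact: powersV.
  by apply: (mulIg w); rewrite mulgVK -mulgA -hef expVgn mulKg.
have hefq q : (h2 ^+ e f) ^+ q * f = f * w ^+ q.
  elim: q => [|q IH]; first by rewrite !expg0 mulg1 mul1g.
  by rewrite !expgS -mulgA IH !mulgA hef.
exists (h2 ^+ (j %% e f) * f).
  apply/allpairsP; exists (h2 ^+ (j %% e f), f); split => //=.
  apply/allpairsP; exists (h2, j %% e f)%N; split => //=.
    by case: s2 => ->; rewrite !inE eqxx ?orbT.
  rewrite mem_iota add0n /=; apply: (@leq_trans (e f)).
    by rewrite ltn_mod; case: Qf.
  by apply: leq_bigmax_seq.
have hj : h2 ^+ j = h2 ^+ (j %% e f) * (h2 ^+ e f) ^+ (j %/ e f).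
  by rewrite -expgnA -expgnDr mulnC addnC -divn_eq.
have -> : g = (h2 ^+ (j %% e f) * f) * (w ^+ (j %/ e f) * v).
  by rewrite gE hj -!mulgA (mulgA (_ ^+ _ ^+ _)) hefq -!mulgA.
rewrite mulKg.
by apply: powersM => //; apply: powers_expg.
Qed.

Lemma powers_square x : powers h x ->
  powers (h ^+ 2) x \/ powers (h ^+ 2) (h^-1 * x).
Proof.
have even g m : ~~ odd m -> g ^+ m = (g ^+ 2) ^+ m./2.
  by move=> evm; rewrite -expgnA mul2n even_halfK.
have cV n : powers (h ^+ 2) ((h^-1 ^+ 2) ^+ n).
  by rewrite expVgn; apply: powers_expg; apply: powersV; apply: (powersX _ 1).
case/powers_sign => n [] ->; case: (boolP (odd n)) => n2.
- right; case: n n2 => // n n2.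
  by rewrite (expgS h n) mulKg (even h n) //; exact: powersX.
- by left; rewrite (even h n) //; exact: powersX.
- right; have := cV n.+1./2.
  by rewrite -(even h^-1 n.+1) /= ?negbK // (expgS h^-1 n).
- by left; rewrite (even h^-1 n).
Qed.

Lemma powers_square_finite_index (R : seq G) :
  (forall g, exists2 r, r \in R & powers h (r^-1 * g)) ->
  finite_index (powers (h ^+ 2)).
Proof.
move=> cov; apply: (@finite_index_cover _ _ (R ++ [seq r * h | r <- R])).
  exact: powers_subgroup.
move=> g; have [r rR /powers_square[]] := cov g => hrg.
  by exists r; rewrite // mem_cat rR.
exists (r * h); last by rewrite invMg -mulgA.
by rewrite mem_cat; apply/orP; right; apply/mapP; exists r.
Qed.

Lemma powers_square_notin : ~ powers (h ^+ 2) h.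
Proof.
case=> m [n]; rewrite -!expgnA => e.
have : h ^+ (2 * n).+1 = h ^+ (2 * m)%N by rewrite expgS {1}e mulgVK.
by move/(lox_inj hl hlox); lia.
Qed.

(** Greedy choice: the elements to avoid at each step form finitely many left
    cosets of the powers of h, which cannot cover G. *)
Lemma transverse_family (T : finType) : ~ finite_index (powers (h ^+ 2)) ->
  exists gam : T -> G,
    forall t t', t != t' -> transverse len h ((gam t)^-1 * gam t').
Proof.
move=> infi; have [R RP] := not_transverse_cosets.
have avoid (L : seq G) :
    exists g, forall a, a \in L -> transverse len h (a^-1 * g).
  apply: contrapT => no; apply: infi.
  apply: (@powers_square_finite_index [seq a * r | a <- L, r <- R]) => g.
  have [a aL /RP[r rR har]] :
      exists2 a, a \in L & ~ transverse len h (a^-1 * g).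
    apply: contrapT => no'; apply: no; exists g => a aL.
    by apply: contrapT => dep; apply: no'; exists a.
  exists (a * r); first by apply/allpairsP; exists (a, r).
  by rewrite invMg -mulgA.
have [l sl lP] : exists2 l : seq G, size l = #|T| &
    forall i j, i < j < size l -> transverse len h ((nth 1 l i)^-1 * nth 1 l j).
  elim: #|T| => [|n [l sl lP]].
    by exists [::] => // i j; rewrite ltn0 andbF.
  have [g gP] := avoid l; exists (rcons l g); first by rewrite size_rcons sl.
  move=> i j; rewrite size_rcons ltnS => /andP[ij jl].
  have il := leq_trans ij jl; rewrite !nth_rcons il.
  case: ltngtP jl => // [jl _|_ _]; first by apply: lP; rewrite ij.
  by apply: gP; rewrite mem_nth.
exists (fun t => nth 1 l (enum_rank t)) => t t' tt'.
have lt (t0 : T) : enum_rank t0 < size l by rewrite sl.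
case: (ltngtP (enum_rank t) (enum_rank t')) => [lt1|lt1|e].
- by apply: lP; rewrite lt1 lt.
- rewrite -[_^-1 * _]invgK invMg invgK.
  by apply: (transverseV hl); apply: lP; rewrite lt1 lt.
- by case/eqP: tt'; apply: enum_rank_inj; apply: val_inj.
Qed.

End Independence.
End Transversality.
(** * Reduced words and free bases *)

Section Words.
Local Open Scope group_scope.
Variable T : eqType.
Implicit Types (a b : T * bool) (w : seq (T * bool)).

(** A letter is an index with a flag that is set for the inverse generator. *)
Definition letter_inv a := (a.1, ~~ a.2).

(** A word is reduced when it is sorted for this relation. *)
Definition noncancel a b := b != letter_inv a.

Definition push_letter a w := if w is b :: w' then
  if b == letter_inv a then w' else a :: w else [:: a].

Definition reduce_word w := foldr push_letter [::] w.

Lemma push_sorted a w :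
  sorted noncancel w -> sorted noncancel (push_letter a w).
Proof.
case: w => [|b w] //=; case: ifP => [_|ne] sw; first exact: path_sorted sw.
by rewrite /= /noncancel ne.
Qed.

Lemma reduce_sorted w : sorted noncancel (reduce_word w).
Proof. by elim: w => //= a w IH; apply: push_sorted. Qed.

Section Eval.
Variables (K : groupType) (f : T -> K).

Definition letter_val a := if a.2 then (f a.1)^-1 else f a.1.

Definition word_val w := prodw (map letter_val w).

Lemma letter_valV a : letter_val (letter_inv a) = (letter_val a)^-1.
Proof. by case: a => t []; rewrite /letter_val //= invgK. Qed.

Lemma word_val_cons a w : word_val (a :: w) = letter_val a * word_val w.
Proof. by []. Qed.

Lemma word_val_cat w1 w2 : word_val (w1 ++ w2) = word_val w1 * word_val w2.
Proof. by rewrite /word_val map_cat prodw_cat. Qed.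

Lemma word_val_push a w :
  word_val (push_letter a w) = letter_val a * word_val w.
Proof.
case: w => [|b w] //=; case: eqP => [->|//].
by rewrite word_val_cons letter_valV mulVKg.
Qed.

Lemma word_val_reduce w : word_val (reduce_word w) = word_val w.
Proof. by elim: w => //= a w IH; rewrite word_val_push IH word_val_cons. Qed.

Definition word_inv w := rev (map letter_inv w).

Lemma word_valV w : word_val (word_inv w) = (word_val w)^-1.
Proof.
elim: w => [|a w IH]; first by rewrite /word_val /= invg1.
rewrite /word_inv /= rev_cons -cats1 word_val_cat -/(word_inv w) IH.
rewrite word_val_cons invMg.
by rewrite /word_val /= mulg1 letter_valV.
Qed.

End Eval.
End Words.

Lemma word_val_comp (S T : eqType) (K : groupType) (i : S -> T) (f : T -> K) w :
  word_val f [seq (i a.1, a.2) | a <- w] = word_val (f \o i) w.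
Proof. by rewrite /word_val -map_comp. Qed.

Section Free.
Local Open Scope group_scope.
Variables (G : groupType) (n : nat) (g : 'I_n -> G).

Definition generated_by : set G := range (word_val g).

Lemma generated_by_gen i : generated_by (g i).
Proof. by exists [:: (i, false)] => //; rewrite /word_val /= mulg1. Qed.

Lemma generated_by_subgroup : subgroup generated_by.
Proof.
apply/subgroupP; split; first by exists [::].
- by move=> _ [w _ <-]; exists (word_inv w); rewrite ?word_valV.
- by move=> _ _ [w _ <-] [w' _ <-]; exists (w ++ w'); rewrite ?word_val_cat.
Qed.

(** To extend f, evaluate it on any word that represents x. This does not
    depend on the word: reducing a word changes no evaluation, so a word that
    represents 1 reduces to the empty word. *)
Lemma generated_by_free :
    (forall w, sorted (@noncancel _) w -> word_val g w = 1 -> w = [::]) ->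
  free_of_rank n generated_by.
Proof.
move=> norel; split; first exact: generated_by_subgroup.
exists g; split; first exact: generated_by_gen.
move=> K f.
have rel w : word_val g w = 1 -> word_val f w = 1.
  rewrite -(word_val_reduce g) -(word_val_reduce f) => /norel -> //.
  exact: reduce_sorted.
have ker w w' : word_val g w = word_val g w' -> word_val f w = word_val f w'.
  move=> e; apply: divg1_eq; rewrite -word_valV -word_val_cat; apply: rel.
  by rewrite word_val_cat word_valV e mulgV.
pose wd x := xget [::] [set w | word_val g w = x]%classic.
have wdP x : generated_by x -> word_val g (wd x) = x.
  case=> w _ <-.
  exact: (@xgetI _ [::] [set w' | word_val g w' = word_val g w]%classic w).
have [S1 SV SM] := iffLR (subgroupP _) generated_by_subgroup.
exists (fun x => word_val f (wd x)); split.
- move=> x y Hx Hy; rewrite -word_val_cat; apply: ker.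
  by rewrite word_val_cat !wdP //; exact: SM.
- move=> i.
  have -> : f i = word_val f [:: (i, false)] by rewrite /word_val /= mulg1.
  by apply: ker; rewrite wdP ?/word_val /= ?mulg1 //; exact: generated_by_gen.
- move=> psi psiM psig x Hx; rewrite -{1}(wdP x Hx).
  elim: (wd x) => [|[i s] w IH].
    apply: (mulgI (psi 1)); rewrite /word_val /= mulg1.
    by rewrite -(psiM 1 1) // mulg1.
  rewrite !word_val_cons psiM ?IH; last by exists w.
    congr (_ * _); rewrite /letter_val /=; case: s; last exact: psig.
    have psi1 : psi 1 = 1.
      by apply: (mulgI (psi 1)); rewrite -psiM // !mulg1.
    apply: (mulgI (psi (g i))); rewrite -psiM ?mulgV ?psi1 ?psig ?mulgV //.
      exact: generated_by_gen.
    by apply: SV; exact: generated_by_gen.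
  by rewrite /letter_val; case: s => /=; [apply: SV|]; exact: generated_by_gen.
Qed.

End Free.

(** * Schottky families *)

Lemma fin_bound (T : finType) (P : T -> nat -> Prop) :
    (forall t D D', D <= D' -> P t D -> P t D') ->
  (forall t, exists D, P t D) -> exists D, forall t, P t D.
Proof.
move=> mono /choice[f fP]; exists (\max_t f t)%N => t.
exact: mono (leq_bigmax t) (fP t).
Qed.

Section Schottky.
Local Open Scope group_scope.
Variables (G : groupType) (len : G -> nat) (k : nat).
Hypothesis hl : hyperbolic_length len k.
Implicit Types (x y z c u v : G) (C D L : nat).
Local Notation dist := (len_dist len).
Local Notation gp := (len_gp len).
Local Notation almost_additive := (len_additive len).
Local Notation lox := (loxodromic len k).
Ltac mlia := metric_lia len.

(** Reduced words in the c t are then chains, provided L exceeds C + 2 k. *)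
Definition schottky (T : eqType) C L (c : T -> G) :=
  (forall a b, noncancel a b ->
     almost_additive C (letter_val c a) (letter_val c b)) /\
  (forall t, L <= len (c t)).

Lemma len_letter (T : eqType) (c : T -> G) a :
  len (letter_val c a) = len (c a.1).
Proof. by case: a => t []; rewrite /letter_val //= (hl_lenV hl). Qed.

(** The translates by gam t of the axis of h share no ends pairwise. So the
    conjugates of h ^+ m by the gam t form a Schottky family whose constant C
    depends on the gam t but not on m, while their lengths grow with m. *)
Lemma schottky_powers (T : finType) (K : set G) h :
    subgroup K -> (forall x y, K x -> K (y * x * y^-1)) -> K h -> lox h ->
    ~ finite_index (powers (h ^+ 2)) ->
  exists C, forall L, exists c : T -> G, (forall t, K (c t)) /\ schottky C L c.
Proof.
move=> sK nK Kh hlox infi; have [K1 KV KM] := iffLR (subgroupP _) sK.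
have [gam gamP] := transverse_family hl hlox T infi.
have [q qP] : exists q, forall t, len (gam t) <= q.
  by exists (\max_t len (gam t))%N => t; apply: leq_bigmax.
have [D DP] : exists D, forall tt : T * T, tt.1 != tt.2 ->
    forall u v, powers h u -> powers h v ->
      len u + len v <= len (u^-1 * ((gam tt.1)^-1 * gam tt.2) * v) + D.
  apply: (@fin_bound _ (fun tt D => tt.1 != tt.2 ->
    forall u v, powers h u -> powers h v ->
      len u + len v <= len (u^-1 * ((gam tt.1)^-1 * gam tt.2) * v) + D)).
    move=> tt D D' le H ne u v hu hv; apply: leq_trans (H ne u v hu hv) _.
    by rewrite leq_add2l.
  move=> tt; case: (eqVneq tt.1 tt.2) => [_|ne]; first by exists 0.
  by have [D HD] := gamP _ _ ne; exists D.
exists (D + len h + 6 * q)%N => L; pose m := (L + 2 * q)%N.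
exists (fun t => gam t * h ^+ m * (gam t)^-1); split.
  move=> t; apply: nK; elim: m => [|m IH]; first by rewrite expg0.
  by rewrite expgS; apply: KM.
split; last first.
  move=> t; have := loxX_len hl hlox m; have := qP t.
  have := hl_lenM hl (gam t)^-1 (gam t * h ^+ m * (gam t)^-1 * gam t).
  have := hl_lenM hl (gam t * h ^+ m * (gam t)^-1) (gam t).
  by rewrite mulgVK mulKg !(hl_lenV hl) /m; mlia.
(* The letters of the family are the conjugates of e false and e true. *)
pose e (s : bool) := if s then h^-1 ^+ m else h ^+ m.
have lvE t s : letter_val (fun t => gam t * h ^+ m * (gam t)^-1) (t, s) =
    gam t * e s * (gam t)^-1.
  by case: s; rewrite /letter_val /= ?expVgn //; gnorm.
have he s : powers h (e s).
  by case: s; [apply: powers_of_inv|]; exact: powersX.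
case=> [t s] [t' s']; rewrite !lvE /noncancel /letter_inv /= => ab.
have eP : len (e s) + len (e s') <=
    len (e s * ((gam t)^-1 * gam t') * e s') + (D + len h).
  case: (eqVneq t t') ab => [<-|ne] ab.
    have -> : s' = s.
      by move: ab; rewrite xpair_eqE eqxx; case: (s) (s') => [] [].
    rewrite mulVg mulg1.
    have : sign_of h (if s then h^-1 else h) by case: (s); [right|left].
    move=> sg; have := loxX_additive hl (sign_lox hl hlox sg) m m.
    by rewrite (sign_len hl sg) /e; case: (s) => /=; mlia.
  have := DP (t, t') ne _ _ (powersV (he s)) (he s').
  by rewrite /= invgK (hl_lenV hl); mlia.
have Lt t0 s0 : len (gam t0 * e s0 * (gam t0)^-1) <= len (e s0) + 2 * q.
  have := hl_lenM hl (gam t0 * e s0) (gam t0)^-1.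
  have := hl_lenM hl (gam t0) (e s0).
  by have := qP t0; rewrite (hl_lenV hl); mlia.
have := Lt t s; have := Lt t' s'.
set X := gam t * e s * (gam t)^-1 * (gam t' * e s' * (gam t')^-1).
have : len (e s * ((gam t)^-1 * gam t') * e s') <= len X + 2 * q.
  have -> : e s * ((gam t)^-1 * gam t') * e s' = (gam t)^-1 * X * gam t'.
    by rewrite /X; gnorm.
  have := hl_lenM hl ((gam t)^-1 * X) (gam t').
  have := hl_lenM hl (gam t)^-1 X.
  by have := qP t; have := qP t'; rewrite (hl_lenV hl); mlia.
rewrite /len_additive -/X; mlia.
Qed.

(** Multiplying x t on both sides by long elements of a Schottky family gives
    elements whose first and last pieces do not cancel in reduced words. Only
    the inner product may collapse: x t * c' could run back along c. As c' and
    its inverse go in different directions, at least one of them can be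
    used. *)
Lemma schottky_twist (T : finType) (K : set G) (x : T -> G) :
    (exists C, forall L, exists c : T * bool -> G,
      (forall t, K (c t)) /\ schottky C L c) ->
    (forall y, K y -> K y^-1) ->
  exists C, exists g : T -> G, schottky C (C + k.*2).+1 g /\
    forall t, exists c c', [/\ K c, K c' & g t = c * x t * c'].
Proof.
case=> C HC KV.
have [q qP] : exists q, forall t, len (x t) <= q.
  by exists (\max_t len (x t))%N => t; apply: leq_bigmax.
(* C1 bounds the cancellation in c * (x * c'), C2 that of either end piece
   against the rest of the product, and L makes the pieces long enough for
   both extension lemmas. *)
pose C1 := (C + 2 * q + k)%N.
pose C2 := (C1 + 2 * q)%N.
pose L := (C + C2 + 6 * k + q).+1%N.
have [c [Kc [cC cL]]] := HC L.
pose b t s := letter_val c ((t, true), s).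
have eP t : exists s, almost_additive C1 (c (t, false)) (x t * b t s).
  set p1 := x t * c (t, true); set p2 := x t * (c (t, true))^-1.
  have : gp p1 p2 <= C + 2 * q.
    have := gpE hl p1 p2; rewrite /p1 /p2 distM distE -invMg (hl_lenV hl).
    have : almost_additive C (c (t, true)) (c (t, true)).
      apply: (cC ((t, true), false) ((t, true), false)).
      by rewrite /noncancel /letter_inv /= xpair_eqE andbF.
    have := hl_lenM hl (x t) (c (t, true)).
    have := hl_lenM hl (x t) (c (t, true))^-1.
    by have := qP t; rewrite (hl_lenV hl); mlia.
  (* x * c' and x * c'^-1 go in different directions, so c^-1 is close to at
     most one of them. *)
  move=> g12; have g12' := gp_min hl (c (t, false))^-1 p1 p2.
  have E s : gp (c (t, false))^-1 (x t * b t s) <= C1 ->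
      almost_additive C1 (c (t, false)) (x t * b t s).
    have := gpE hl (c (t, false))^-1 (x t * b t s).
    by rewrite distE invgK (hl_lenV hl); mlia.
  have [le1|gt1] := leqP (gp (c (t, false))^-1 p1) C1.
    by exists false; apply: E.
  exists true; apply: E; rewrite -[x t * b t true]/p2.
  by move: gt1 g12'; rewrite (gpC hl p1) /C1; mlia.
have /choice[s sP] := eP.
pose g t := c (t, false) * x t * b t (s t).
pose first_letter (a : T * bool) : (T * bool) * bool :=
  if a.2 then ((a.1, true), ~~ s a.1) else ((a.1, false), false).
pose last_letter (a : T * bool) : (T * bool) * bool :=
  if a.2 then ((a.1, false), true) else ((a.1, true), s a.1).
have lb t s0 : len (b t s0) = len (c (t, true)) by rewrite /b len_letter.
have g_ends t : almost_additive C2 (c (t, false)) ((c (t, false))^-1 * g t) /\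
    almost_additive C2 (g t * (b t (s t))^-1) (b t (s t)).
  have := sP t; have := qP t; rewrite /g mulgK /len_additive -!mulgA mulKg.
  have := hl_lenM hl (c (t, false)) (x t); have := hl_lenM hl (x t) (b t (s t)).
  have := hl_lenM hl (x t)^-1 (x t * b t (s t)); rewrite mulKg (hl_lenV hl).
  by rewrite /C2; split; mlia.
have fstP a : let e := letter_val c (first_letter a) in
    almost_additive C2 e (e^-1 * letter_val g a).
  case: a => t [] /=; rewrite /first_letter /=; last by case: (g_ends t).
  have [_] := g_ends t; rewrite -(almost_additiveV hl).
  have -> : letter_val c (t, true, ~~ s t) = (b t (s t))^-1.
    by rewrite -[RHS]letter_valV.
  by rewrite invMg !invgK.
have lstP a : let e := letter_val c (last_letter a) in
    almost_additive C2 (letter_val g a * e^-1) e.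
  case: a => t [] /=; rewrite /last_letter /=; last by case: (g_ends t).
  have [+ _] := g_ends t; rewrite -(almost_additiveV hl).
  by rewrite invMg !invgK.
have lst_fst a a' :
    noncancel a a' -> noncancel (last_letter a) (first_letter a').
  rewrite /noncancel /letter_inv /last_letter /first_letter.
  case: a a' => t [] [t' []] /=; rewrite !xpair_eqE ?andbT ?andbF //=.
  by move/negbTE->.
have lc a : L <= len (letter_val c a) by rewrite len_letter.
exists (C + k + k)%N; exists g; split; last first.
  move=> t; exists (c (t, false)), (b t (s t)); split=> //.
  by rewrite /b /letter_val /=; case: (s t); [apply: KV|].
split.
  move=> a a' /lst_fst rd.
  apply: (almost_additive_extl hl (lstP a)).
    apply: (almost_additive_extr hl (cC _ _ rd) (fstP a')).
    by have := lc (first_letter a'); rewrite /L; mlia.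
  by have := lc (last_letter a); rewrite /L; mlia.
move=> t; have := sP t; have := cL (t, false); have := cL (t, true).
have := hl_lenM hl (x t)^-1 (x t * b t (s t)); rewrite mulKg (hl_lenV hl) lb.
by have := qP t; rewrite /g -mulgA /L /C2 /C1; mlia.
Qed.

Section Embedded.
Variables (T : eqType) (C : nat) (g : T -> G).
Hypothesis gC : schottky C (C + k.*2).+1 g.

Lemma schottky_chain w :
  sorted (@noncancel _) w -> chain len k C (map (letter_val g) w).
Proof.
case: gC => gr gL sw; apply/andP; split.
  by rewrite sorted_map; apply: sub_sorted sw => a b /= /gr.
by apply/allP => _ /mapP[a _ ->]; rewrite /long len_letter; apply: gL.
Qed.

Lemma schottky_no_relation w :
  sorted (@noncancel _) w -> word_val g w = 1 -> w = [::].
Proof.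
move=> sw e; case: w sw e => // a w /schottky_chain/(chain_gt0 hl)/(_ _)H e.
have := H (ltac:(by [])); rewrite -/(word_val g (a :: w)) e (hl_len1 hl).
by [].
Qed.

End Embedded.
End Schottky.
(** * The word metric *)

Section WordMetric.
Local Open Scope group_scope.
Variables (G : groupType) (A : set G).
Hypothesis hA : finite_symmetrized_generating_set A.
Implicit Types (x y z a u v : G) (p q : seq G).
Local Notation d := (word_dist A).

Ltac word_lia := revert_props;
  repeat (let n := fresh "n" in set n := (word_dist _ _ _); clearbody n); lia.

Lemma cayleyE x y : cayley A x y = (x^-1 * y \in A). Proof. by []. Qed.

Lemma edge_path_cat x y z p q :
  edge_path A x y p -> edge_path A y z q -> edge_path A x z (p ++ q).
Proof.
by move=> [pp <-] [pq <-]; split; rewrite ?last_cat // cat_path pp.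
Qed.

Lemma edge_path_mul a x y p :
  edge_path A x y p -> edge_path A (a * x) (a * y) (map ( *%g a) p).
Proof.
move=> [pp <-]; split; last by rewrite last_map.
rewrite path_map; apply: sub_path pp => u v.
by rewrite !cayleyE /= cayleyE invMg -mulgA mulKg.
Qed.

Lemma cayleyC x y : cayley A x y -> cayley A y x.
Proof.
have [_ AV _] := hA; rewrite !cayleyE !in_setE => /AV.
by rewrite invMg invgK.
Qed.

Lemma edge_path_rev x y p :
  edge_path A x y p -> exists2 q, edge_path A y x q & size q = size p.
Proof.
elim: p x => [|z p IH] x [] /=; first by move=> _ <-; exists [::].
move=> /andP[xz pp] lp; have [q yq sq] := IH z (conj pp lp).
exists (rcons q x); last by rewrite size_rcons sq.
rewrite -cats1; apply: edge_path_cat yq _; split=> //=.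
by rewrite andbT cayleyC.
Qed.

Lemma edge_path_exists x y : exists p, edge_path A x y p.
Proof.
have [_ _ Agen] := hA.
pose S : set G := [set g | exists p, edge_path A 1 g p]%classic.
have SS : S = setT.
  apply/seteqP; split=> // g _.
  have : smallest (@subgroup G) A g by rewrite Agen.
  apply; split; last first.
    move=> a Aa; exists [:: a]; split=> //=.
    by rewrite andbT cayleyE invg1 mul1g in_setE.
  apply/subgroupP; split; first by exists [::].
    move=> u [p /(edge_path_mul u^-1)/edge_path_rev[q]].
    by rewrite mulVg mulg1; exists q.
  move=> u v [p pu] [q /(edge_path_mul u)]; rewrite mulg1 => qv.
  by exists (p ++ map ( *%g u) q); exact: edge_path_cat qv.
have : S (x^-1 * y) by rewrite SS.
by case=> p /(edge_path_mul x); rewrite mulg1 mulVKg; exists (map ( *%g x) p).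
Qed.

Lemma geodesic_exists x y : exists p, geodesic A x y p.
Proof.
have ex : exists n, `[< exists2 p, edge_path A x y p & size p = n >].
  have [p xy] := edge_path_exists x y.
  by exists (size p); apply/asboolP; exists p.
case: (ex_minnP ex) => n /asboolP[p xy <-] nmin.
by exists p; split=> // q qxy; apply: nmin; apply/asboolP; exists q.
Qed.

Lemma geodesic_size x y p : geodesic A x y p -> size p = d x y.
Proof.
move=> gp; have [q [qxy qmin] <-] :
  [set size p | p in geodesic A x y]%classic (d x y).
  by apply: (@xgetI _ 0 _ (size p)); exists p.
by case: gp => pxy pmin; apply/eqP; rewrite eqn_leq pmin // qmin.
Qed.

Lemma word_dist_le x y p : edge_path A x y p -> d x y <= size p.
Proof.
move=> xy; have [q gq] := geodesic_exists x y.
by rewrite -(geodesic_size gq); case: gq => _; apply.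
Qed.

Lemma word_dist_path x y : exists2 p, edge_path A x y p & size p = d x y.
Proof.
have [q gq] := geodesic_exists x y; exists q; first by case: gq.
exact: geodesic_size.
Qed.

Lemma word_dist_triangle x y z : d x z <= d x y + d y z.
Proof.
have [p xy <-] := word_dist_path x y; have [q yz <-] := word_dist_path y z.
by rewrite -size_cat; apply: word_dist_le; apply: edge_path_cat yz.
Qed.

Lemma word_distM a x y : d (a * x) (a * y) = d x y.
Proof.
have le b u v : d (b * u) (b * v) <= d u v.
  have [p uv <-] := word_dist_path u v.
  by rewrite -(size_map ( *%g b) p); apply: word_dist_le; apply: edge_path_mul.
apply/eqP; rewrite eqn_leq le /=.
by have := le a^-1 (a * x) (a * y); rewrite !mulKg.
Qed.

Lemma word_distC x y : d x y = d y x.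
Proof.
have le u v : d u v <= d v u.
  have [p vu <-] := word_dist_path v u; have [q uv <-] := edge_path_rev vu.
  exact: word_dist_le.
by apply/eqP; rewrite eqn_leq !le.
Qed.

Lemma word_distE x y : d x y = d 1 (x^-1 * y).
Proof. by rewrite -(word_distM x 1) mulg1 mulVKg. Qed.

Lemma geodesic_mem x y z p : geodesic A x y p -> z \in x :: p ->
  d x z + d z y = d x y.
Proof.
move=> gp; rewrite inE => /orP[/eqP->|/path.splitPr zp].
  have : d x x <= size (Nil G) by apply: word_dist_le.
  by rewrite leqn0 => /eqP->.
case: zp gp => p1 p2 gp.
have [[xy lp] _] := gp; have sp := geodesic_size gp.
move: xy lp sp; rewrite -cat_rcons cat_path last_cat size_cat last_rcons.
move=> /andP[xz zy] lp sp.
have := @word_dist_le x z (rcons p1 z) (conj xz (last_rcons _ _ _)).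
have := @word_dist_le z y p2 (conj zy lp).
have := word_dist_triangle x z y; word_lia.
Qed.

Lemma word_dist_hyperbolic : hyperbolic A ->
  exists k, hyperbolic_length (word_dist A 1) k.
Proof.
case=> delta hd; exists delta.*2; split.
- have : d 1 1 <= size (Nil G) by apply: word_dist_le.
  by rewrite leqn0 => /eqP.
- by move=> x; rewrite word_distC word_distE mulg1 invgK.
- move=> x y; have := word_dist_triangle 1 x (x * y).
  by rewrite [d x _]word_distE mulKg.
- move=> x y z t; rewrite -!word_distE.
  have := hd t x y z.
  rewrite /gromov_product Num.Theory.lerBlDr Order.TotalTheory.ge_min => H.
  have {H}[H|H] := orP H.
    have : ((d x t + d z t + d x y)%:R
        <= (d x t + d y t + d x z + delta.*2)%:R :> rat)%R.
      by rewrite !GRing.Theory.natrD -addnn GRing.Theory.natrD; lra.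
    by rewrite Num.Theory.ler_nat; lia.
  have : ((d z t + d y t + d x y)%:R
      <= (d x t + d y t + d z y + delta.*2)%:R :> rat)%R.
    by rewrite !GRing.Theory.natrD -addnn GRing.Theory.natrD; lra.
  by rewrite Num.Theory.ler_nat (word_distC z y); lia.
- move=> x r le_r; have [p [xp lp] sp] := word_dist_path 1 x.
  move: xp lp; rewrite -{1 2}(cat_take_drop r p) cat_path last_cat.
  move=> /andP[p1 p2] lp; exists (last 1 (take r p)).
    have := word_dist_le (conj p1 erefl); have := word_dist_le (conj p2 lp).
    have := word_dist_triangle 1 (last 1 (take r p)) x.
    by rewrite size_drop size_takel ?sp //; word_lia.
  rewrite -word_distE.
  have := word_dist_le (conj p1 erefl); have := word_dist_le (conj p2 lp).
  have := word_dist_triangle 1 (last 1 (take r p)) x.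
  by rewrite size_drop size_takel ?sp //; word_lia.
- elim=> [|r IH].
    apply: sub_finite_set (finite_set1 (1 : G)) => x /=.
    have [p [_ lp] <-] := word_dist_path 1 x.
    by rewrite leqn0 size_eq0 => /eqP pE; rewrite -lp pE.
  have [Afin _ _] := hA.
  pose B := [set x | d 1 x <= r]%classic.
  apply: (@sub_finite_set _ _ (B `|` [set x * y | x in B & y in A])%classic);
    last first.
    rewrite finite_setU; split; first exact: IH.
    by apply: (finite_image2 (fun x y => x * y)).
  move=> x /=; have [p [xp lp] <-] := word_dist_path 1 x.
  case/lastP: p xp lp => [|p y].
    move=> _ /= <- _; left => /=.
    have : d 1 1 <= size (Nil G) by apply: word_dist_le.
    by move/leq_trans; apply.
  rewrite size_rcons rcons_path last_rcons ltnS => /andP[p1 e] yx le_p.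
  right; exists (last 1 p).
    by apply: leq_trans le_p; apply: word_dist_le.
  exists ((last 1 p)^-1 * x); last by rewrite mulVKg.
  by move: e; rewrite cayleyE yx in_setE.
Qed.

(** A geodesic between two elements u and v of the subgroup is a translate of a
    geodesic from 1 to a reduced word, and by chain_track it stays close to the
    prefixes of this word, which lie in the subgroup. *)
Lemma generated_by_quasiconvex n (g : 'I_n -> G) k C :
  hyperbolic_length (word_dist A 1) k ->
  schottky (word_dist A 1) C (C + k.*2).+1 g -> quasiconvex A (generated_by g).
Proof.
move=> hl gC; pose M := (\max_i d 1 (g i))%N.
have [S1 SV SM] := iffLR (subgroupP _) (generated_by_subgroup g).
exists (M + C + k.*2 + k)%N => u v p Hu Hv guv z zp.
have [w _ wE] : generated_by g (u^-1 * v) by apply: SM => //; exact: SV.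
rewrite -(word_val_reduce g) in wE; have sw := reduce_sorted w.
set w' := reduce_word w in wE sw.
have := chain_track hl (M := M) (schottky_chain hl gC sw) (z := u^-1 * z).
case.
- apply/allP => _ /mapP[a _ ->]; rewrite (len_letter hl).
  exact: (leq_bigmax (F := fun i => d 1 (g i))).
- rewrite -/(word_val g w') wE /len_dist -!word_distE.
  by rewrite word_distM (geodesic_mem guv zp).
move=> w1 [w2 e]; rewrite /len_dist -word_distE => le_w1.
exists (u * prodw w1); last first.
  by rewrite -(word_distM u^-1) mulKg.
apply: SM => //; exists (take (size w1) w') => //.
by rewrite /word_val map_take e take_size_cat.
Qed.

End WordMetric.
(** * The finite residual *)

Local Open Scope classical_set_scope.

Section Residual.
Local Open Scope group_scope.
Variable G : groupType.
Implicit Types (x y g : G) (L K : set G).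

Lemma finite_index_reps L : subgroup L -> finite_index L ->
  exists R : seq G, forall g, exists2 r, r \in R & L (r^-1 * g).
Proof.
move=> /subgroupP[L1 LV LM] /finite_seqP[s sE].
exists [seq xget 1 C | C <- s] => g.
have : left_cosets L [set g * x | x in L] by exists g.
rewrite sE => gs; set C := [set g * x | x in L] in gs.
exists (xget 1 C); first by apply/mapP; exists C.
have : C (xget 1 C) by apply: (@xgetI _ 1 C g); exists 1; rewrite ?mulg1.
by case=> x Lx <-; rewrite invMg mulgVK; apply: LV.
Qed.

Lemma conj_finite_index L y : subgroup L -> finite_index L ->
  let M := [set x | L (y * x * y^-1)] in subgroup M /\ finite_index M.
Proof.
move=> sL fL M; have [L1 LV LM] := iffLR (subgroupP _) sL.
have sM : subgroup M.
  apply/subgroupP; split=> [|x|x x'].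
  - by rewrite /M /= mulg1 mulgV.
  - rewrite /M /= => /LV; rewrite !invMg invgK !mulgA; exact.
  - move=> Mx Mx'; rewrite /M /=.
    have -> : y * (x * x') * y^-1 = (y * x * y^-1) * (y * x' * y^-1) by gnorm.
    exact: LM.
split=> //; have [R RP] := finite_index_reps sL fL.
apply: (@finite_index_cover _ _ [seq y^-1 * r * y | r <- R]) => // g.
have [r rR Lr] := RP (y * g * y^-1).
exists (y^-1 * r * y); first by apply/mapP; exists r.
by rewrite /M /=; move: Lr; rewrite !invMg invgK !mulgA mulgV mul1g.
Qed.

Lemma finite_residual_sub L g :
  subgroup L -> finite_index L -> finite_residual G g -> L g.
Proof. by move=> sL fL; apply; split. Qed.

Lemma finite_residual_subgroup : subgroup (finite_residual G).
Proof.
apply/subgroupP; split=> [|x Kx|x y Kx Ky] L [sL fL];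
  have [L1 LV LM] := iffLR (subgroupP _) sL => //.
  by apply: LV; apply: Kx.
by apply: LM; [apply: Kx | apply: Ky].
Qed.

Lemma finite_residual_conj x y :
  finite_residual G x -> finite_residual G (y * x * y^-1).
Proof.
by move=> Kx L [sL fL]; have := conj_finite_index y sL fL; apply: Kx.
Qed.

Lemma torsion_free_finite_subgroup K :
  subgroup K -> finite_set K -> torsion_free G -> forall g, K g -> g = 1.
Proof.
move=> /subgroupP[K1 _ KM] /finite_seqP[s sE] tf g Kg.
have Kgn n : g ^+ n \in s.
  suff : [set` s] (g ^+ n) by [].
  rewrite -sE; elim: n => [|n IH]; first by rewrite expg0.
  by rewrite expgS; apply: KM.
have : ~~ uniq [seq g ^+ n | n <- iota 0 (size s).+1].
  apply/negP => /uniq_leq_size-/(_ s); rewrite size_map size_iota ltnn => H.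
  by suff : false by []; apply: H => _ /mapP[n _ ->].
case/(uniqPn 1) => i [j]; rewrite size_map size_iota => -[ltij ltj].
have lti := ltn_trans ltij ltj.
rewrite !(nth_map 0) ?size_iota // !nth_iota // !add0n => e.
apply: (tf g (j - i)%N); first by rewrite subn_gt0.
by rewrite expgnFr ?(ltnW ltij) // e mulgV.
Qed.

Section CosetAction.
Variable L : set G.
Hypothesis sL : subgroup L.
Variable s : seq (set G).
Hypothesis sE : left_cosets L = [set` s].

Let coset := seq_sub s.

Lemma coset_translate g (C : coset) : [set g * x | x in ssval C] \in s.
Proof.
suff : [set` s] [set g * x | x in ssval C] by [].
have : [set` s] (ssval C) by exact: ssvalP.
rewrite -sE => -[y _ <-]; exists (g * y) => //.
apply/seteqP; split => _ [x Lx <-].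
  by exists (y * x); [exists x | rewrite mulgA].
by case: Lx => z Lz <-; exists z; rewrite ?mulgA.
Qed.

Definition translate g (C : coset) : coset := SeqSub (coset_translate g C).

Lemma translateM g g' C : translate (g * g') C = translate g (translate g' C).
Proof.
apply: val_inj; apply/seteqP; split => _ [x Cx <-] /=.
  by exists (g' * x); [exists x | rewrite mulgA].
by case: Cx => z Cz <-; exists z; rewrite ?mulgA.
Qed.

Lemma translate1 C : translate 1 C = C.
Proof.
apply: val_inj; apply/seteqP; split => [_ [x Cx <-]|x Cx] /=.
  by rewrite mul1g.
by exists x; rewrite ?mul1g.
Qed.

Lemma translate_inj g : injective (translate g^-1).
Proof.
apply: (@can_inj _ _ _ (translate g)) => C.
by rewrite -translateM mulgV translate1.
Qed.

(** The product of permutations applies its left factor first, so acting by the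
    inverse makes this a homomorphism. *)
Definition coset_perm g : {perm coset} := perm (@translate_inj g).

Lemma coset_permM : {morph coset_perm : x y / x * y}.
Proof.
by move=> x y; apply/permP => C; rewrite permM !permE invMg translateM.
Qed.

Lemma coset_perm_separates g : coset_perm g = 1 -> L g.
Proof.
have [L1 LV LM] := iffLR (subgroupP _) sL.
have Ls : L \in s.
  suff : [set` s] L by [].
  rewrite -sE; exists 1 => //; apply/seteqP; split => [_ [x Lx <-]|x Lx].
    by rewrite mul1g.
  by exists x; rewrite ?mul1g.
move=> e; have : coset_perm g (SeqSub Ls) = SeqSub Ls by rewrite e perm1.
rewrite permE => /(congr1 val) /= eL.
have : L g^-1 by rewrite -eL; exists 1; rewrite ?mulg1.
by move/LV; rewrite invgK.
Qed.

End CosetAction.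

(** G acts on the finite set of left cosets of L, and only elements of L fix the
    coset L. *)
Lemma residually_finite_of_trivial_residual :
  (forall g, finite_residual G g -> g = 1) -> residually_finite G.
Proof.
move=> triv g g1.
have [L [sL fL] nLg] : exists2 L, subgroup L /\ finite_index L & ~ L g.
  apply: contrapT => no; apply: g1; apply: triv => L LP.
  by apply: contrapT => nLg; apply: no; exists L.
have [s sE] := iffLR (finite_seqP _) fL.
exists {perm seq_sub s}.
pose m := isMultiplicative.Build G {perm seq_sub s} _ (coset_permM sE).
pose phi : {multiplicative G -> {perm seq_sub s}} := HB.pack (coset_perm sE) m.
exists phi => e; apply: nLg.
exact: (coset_perm_separates sL (e : coset_perm sE g = 1)).
Qed.

End Residual.

Theorem theorem1 (G : groupType) (A : set G)
    (hA : finite_symmetrized_generating_set A) (hG : hyperbolic A)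
    (s : nat) (hs : (0 < s)%N)
    (X : set G) (hXs : (X #= `I_s)%card) (hX : generates X)
    (hH : forall H : set G,
       free_of_rank s H -> H <> setT -> quasiconvex A H -> engulfed H) :
  finite_set (finite_residual G) /\
  (torsion_free G -> residually_finite G).
Proof.
suff fK : finite_set (finite_residual G).
  split=> // tf; apply: residually_finite_of_trivial_residual => g.
  apply: torsion_free_finite_subgroup tf g => //.
  exact: finite_residual_subgroup.
apply: contrapT => infK.
set K := finite_residual G in infK.
have sK : subgroup K by apply: finite_residual_subgroup.
have [k hl] := word_dist_hyperbolic hA hG.
have [h Kh hlox] := exists_loxodromic hl sK infK.
(* This rules out the virtually cyclic case: the subgroup generated by
   h ^+ 2 would contain the finite residual, hence h. *)
have infi : ~ finite_index (powers (h ^+ 2)%g).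
  move=> fi; apply: (powers_square_notin hl hlox).
  exact: (finite_residual_sub (powers_subgroup _) fi Kh).
have /card_set_bijP[f [fX finj _]] := hXs.
pose inv_f i := xget 1%g [set z | X z /\ f z = i].
have inv_fK z : X z -> inv_f (f z) = z.
  move=> Xz; have [Xy fy] : X (inv_f (f z)) /\ f (inv_f (f z)) = f z.
    exact: (@xgetI _ 1%g [set z' | X z' /\ f z' = f z] z).
  by apply: finj; rewrite ?in_setE.
pose x (o : option 'I_s) : G := if o is Some i then inv_f i else 1%g.
have nK y z : K y -> K (z * y * z^-1)%g by apply: finite_residual_conj.
have [K1 KV KM] := iffLR (subgroupP _) sK.
have fam := schottky_powers hl (option 'I_s * bool)%type sK nK Kh hlox infi.
have [C [g [gC gx]]] := schottky_twist hl x fam KV.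
pose g' : 'I_s -> G := g \o Some.
have noncancel_Some (a b : 'I_s * bool) :
    noncancel a b -> noncancel (Some a.1, a.2) (Some b.1, b.2).
  rewrite /noncancel /letter_inv.
  by case: a b => i s1 [j s2] /=; rewrite !xpair_eqE.
have g'C : schottky (word_dist A 1%g) C (C + k.*2).+1 g'.
  case: gC => gr gL; split=> [a b ab|i]; last exact: gL.
  exact: gr (noncancel_Some _ _ ab).
have [L [sL fL nL HL]] : engulfed (generated_by g').
  apply: hH.
  - by apply: generated_by_free => w; apply: (schottky_no_relation hl g'C).
  (* An extra generator g None keeps the subgroup proper: it lies outside,
     being free from the others. *)
  - move=> full; have [w _ wE] : generated_by g' (g None) by rewrite full.
    rewrite -(word_val_reduce g') in wE; have sw := reduce_sorted w.
    set w' := reduce_word w in wE sw.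
    pose w2 := (None, true) :: [seq (Some a.1, a.2) | a <- w'].
    suff : w2 = [::] by [].
    apply: (schottky_no_relation hl gC).
      have : sorted (@noncancel _) [seq (Some a.1, a.2) | a <- w'].
        rewrite sorted_map; apply: sub_sorted sw => a b.
        exact: noncancel_Some.
      by rewrite /w2; case: w' {wE sw w2} => [|a w'].
    rewrite word_val_cons (word_val_comp Some g) /= -[g \o Some]/g' wE.
    by rewrite /letter_val /= mulVg.
  - exact: (generated_by_quasiconvex hA hl g'C).
have [L1 LV LM] := iffLR (subgroupP _) sL.
have KL y : K y -> L y by apply: finite_residual_sub.
(* As L contains the finite residual and each c * x * c', it contains X. *)
apply: nL; apply/seteqP; split=> // y _.
have : smallest (@subgroup G) X y by rewrite hX.
apply; split=> // z Xz; have i_s : f z < s by exact: fX.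
have [c [c' [Kc Kc' gE]]] := gx (Some (Ordinal i_s)).
have -> : z = (c^-1 * g (Some (Ordinal i_s)) * c'^-1)%g.
  by rewrite gE /= inv_fK //; gnorm.
apply: (LM); last by apply: LV; apply: KL.
apply: LM; first by apply: LV; apply: KL.
by apply: HL; apply: (generated_by_gen g').
Qed.
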